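(* Let $G$ be a subgroup of the additive group of real numbers $\mathbb{R}$ that contains the group of integers $\mathbb{Z}$. Then the canonical exact sequence $$E=\big(\mathbb{Z}^\sharp\xrightarrow{j}G^\sharp\xrightarrow{p}(G/\mathbb{Z})^\sharp\big)$$ is a $ws$-extension.
   Context: For an Abelian group $G$, $G^\sharp$ denotes the group $G$ equipped with the Bohr topology, i.e. the initial topology with respect to the family of all group homomorphisms $G\to\mathbb{T}$ (all homomorphisms of the abstract group $G$), where $\mathbb{T}=\mathbb{R}/\mathbb{Z}$ has its usual topology. Here $j$ is the inclusion and $p$ is the quotient homomorphism. An extension of topological Abelian groups is a sequence $B\xrightarrow{j}X\xrightarrow{p}A$ of continuous homomorphisms where $p$ is surjective and open and $j$ is a topological embedding with image $p^{-1}(0)$. It is a weak-split extension ($ws$-extension) if there is a continuous map $\mathbf{s}\colon A\to X$ (not necessarily a homomorphism) with $p\mathbf{s}=\mathrm{id}_A$ and $\mathbf{s}(0)=0$. *)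

(* Defs.v *)
From HB Require Import structures.
From mathcomp Require Import all_boot all_order all_algebra.
From mathcomp Require Import generic_quotient ring_quotient.
From mathcomp Require Import all_classical all_reals all_analysis.
Set Implicit Arguments.
Unset Strict Implicit.
Unset Printing Implicit Defensive.
Import Order.TTheory GRing.Theory Num.Theory.
Import numFieldNormedType.Exports.
Local Open Scope classical_set_scope.
Local Open Scope ring_scope.
Local Open Scope quotient_scope.

Record subgroup (V : zmodType) (G : zmodClosed V) : Type :=
  Subgroup { subgroup_val : V; subgroup_valP : subgroup_val \in G }.

HB.instance Definition _ (V : zmodType) (G : zmodClosed V) :=
  [isSub of subgroup G for @subgroup_val V G].
HB.instance Definition _ (V : zmodType) (G : zmodClosed V) :=
  [Choice of subgroup G by <:].
HB.instance Definition _ (V : zmodType) (G : zmodClosed V) :=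
  [SubChoice_isSubZmodule of subgroup G by <:].

Section Inclusion.
Variables (V : zmodType) (H G : zmodClosed V) (HG : {subset H <= G}).

Definition inclusion (x : subgroup H) : subgroup G :=
  Subgroup (HG (subgroup_valP x)).

Lemma inclusion_is_zmod_morphism : zmod_morphism inclusion.
Proof. by move=> x y; apply: val_inj. Qed.

HB.instance Definition _ :=
  GRing.isZmodMorphism.Build _ _ inclusion inclusion_is_zmod_morphism.
End Inclusion.

Section RelativeSubgroup.
Variables (V : zmodType) (G H : zmodClosed V).

(* H as a subgroup of G (H :&: G when H is not contained in G). *)
Definition relative_subgroup : {pred subgroup G} := fun x => val x \in H.

Lemma relative_subgroup_zmod_closed : zmod_closed relative_subgroup.
Proof.
split=> [|x y xH yH]; first by rewrite unfold_in /relative_subgroup raddf0 rpred0.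
by rewrite unfold_in /relative_subgroup raddfB rpredB.
Qed.

HB.instance Definition _ :=
  GRing.isZmodClosed.Build (subgroup G) relative_subgroup
    relative_subgroup_zmod_closed.
End RelativeSubgroup.
Arguments relative_subgroup {V} G H _.

Section Integers.
Variable R : realType.
Definition integers : {pred R} := fun x => x \is a Num.int.

Lemma integers_zmod_closed : zmod_closed integers.
Proof. by split=> [|x y xZ yZ]; [exact: rpred0 | exact: rpredB]. Qed.

HB.instance Definition _ :=
  GRing.isZmodClosed.Build R integers integers_zmod_closed.
End Integers.

Arguments integers R _ : clear implicits.

(* The torus R/Z with the quotient topology of the usual topology of R. *)
Definition circle (R : realType) : Type :=
  quotient_topology (Quotient.quot (integers R)).

HB.instance Definition _ (R : realType) := Quotient.copy (circle R)
  (quotient_topology (Quotient.quot (integers R))).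
HB.instance Definition _ (R : realType) := Topological.copy (circle R)
  (quotient_topology (Quotient.quot (integers R))).
HB.instance Definition _ (R : realType) :=
  @GRing.isZmodule.Build (circle R) _ _ _
    (@Quotient.addqA R (integers R)) (@Quotient.addqC R (integers R))
    (@Quotient.add0q R (integers R)) (@Quotient.addNq R (integers R)).

Section CircleTopology.
Variable R : realType.

Definition circle_pi : R -> circle R := \pi_(circle R).

Lemma circle_piB x y : circle_pi (x - y) = circle_pi x - circle_pi y.
Proof. exact: (@raddfB _ _ (\pi_(Quotient.quot (integers R)))). Qed.

Lemma circle_pi_eq x y : circle_pi x = circle_pi y <-> x - y \is a Num.int.
Proof.
rewrite -[_ \is a _]/((x - y) \in integers R) Quotient.idealrBE.
by split=> /(@eqP (Quotient.quot (integers R))).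
Qed.

Lemma circle_pi_continuous : continuous circle_pi.
Proof. exact: pi_continuous. Qed.

Lemma circle_pi_open (A : set R) : open A -> open (circle_pi @` A).
Proof.
move=> oA; rewrite /open/= /quotient_open -/circle_pi.
rewrite (_ : _ @^-1` _ =
    \bigcup_(n in [set n : R | n \is a Num.int]) ((fun x => x - n) @^-1` A)).
  apply: bigcup_open => n _; move: A oA; apply/continuousP => x.
  by apply: cvgB; [exact: cvg_id | exact: cvg_cst].
apply/seteqP; split=> x /=.
  by move=> [a Aa /esym/circle_pi_eq xa]; exists (x - a) => //=; rewrite subKr.
move=> [n /= nZ Axn]; exists (x - n) => //.
by apply/esym/circle_pi_eq; rewrite subKr.
Qed.

Lemma circle_pi_nbhs (a : R) (A : set R) :
  nbhs a A -> nbhs (circle_pi a) (circle_pi @` A).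
Proof.
rewrite nbhsE => -[B [oB Ba] BA].
apply: (@filterS _ _ _ (circle_pi @` B)); first exact: image_subset.
by apply: open_nbhs_nbhs; split; [exact: circle_pi_open | exists a].
Qed.

Lemma circle_sub_continuous : continuous (fun x : circle R * circle R => x.1 - x.2).
Proof.
move=> [x y]; rewrite -[x]reprK -[y]reprK.
move: (repr x) (repr y) => a b U /=; rewrite -/circle_pi -circle_piB.
move=> /circle_pi_continuous /(@sub_continuous R (a, b)) [[A B] /= [aA bB] ABU].
exists (circle_pi @` A, circle_pi @` B) => /=.
  by split; exact: circle_pi_nbhs.
move=> [_ _] /= [[a' Aa' <-] [b' Bb' <-]]; rewrite -circle_piB.
exact: (ABU (a', b')).
Qed.

HB.instance Definition _ :=
  PreTopologicalNmodule_isTopologicalZmodule.Build (circle R)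
    circle_sub_continuous.
End CircleTopology.
Arguments circle_pi {R}.

(* The group G with the initial topology of the family of all homomorphisms
   from the abstract group G to R/Z, that is, the supremum of the initial
   topologies of the individual homomorphisms. *)
Definition bohr (R : realType) (G : zmodType) : Type :=
  @sup_topology G {additive G -> circle R}
    (fun f => Topological.class (initial_topology f)).

HB.instance Definition _ (R : realType) (G : zmodType) :=
  GRing.Zmodule.copy (bohr R G) G.
HB.instance Definition _ (R : realType) (G : zmodType) :=
  Topological.copy (bohr R G) (@sup_topology G {additive G -> circle R}
    (fun f => Topological.class (initial_topology f))).

Section BohrTopology.
Variables (R : realType) (G : zmodType).

Lemma bohr_hom_continuous (f : {additive G -> circle R}) :
  continuous (f : bohr R G -> circle R).
Proof.
move=> x; have : nbhs x --> (x : bohr R G) by [].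
move=> /(@cvg_sup _ _ _ _ (x : G)) /(_ f) cx.
move=> U /(@initial_continuous _ _ f x) fU; exact: (cx (@nbhs_filter (bohr R G) x) _ fU).
Qed.

Lemma bohr_sub_continuous :
  continuous (fun x : bohr R G * bohr R G => x.1 - x.2).
Proof.
move=> x; apply/(@cvg_sup _ _ _ _ (x.1 - x.2 : G)) => f; move: x.
apply: (@continuous_comp_initial _ _ _ f
          (fun x : bohr R G * bohr R G => x.1 - x.2)).
have -> : f \o (fun x : bohr R G * bohr R G => x.1 - x.2) =
    fun x : bohr R G * bohr R G => f x.1 - f x.2.
  by apply/funext => x; exact: (raddfB f).
have cf := @bohr_hom_continuous f.
move: (f : bohr R G -> circle R) cf => g cg x.
apply: (@continuous_comp _ _ _
  (fun x : bohr R G * bohr R G => (g x.1, g x.2))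
  (fun y : circle R * circle R => y.1 - y.2)); last exact: sub_continuous.
apply: (@cvg_pair _ _ _ _ _ _ (nbhs_filter x)
  (nbhs_filter (g x.1)) (nbhs_filter (g x.2))).
  by apply: (@continuous_comp _ _ _ fst g); [exact: cvg_fst | exact: cg].
by apply: (@continuous_comp _ _ _ snd g); [exact: cvg_snd | exact: cg].
Qed.

HB.instance Definition _ :=
  PreTopologicalNmodule_isTopologicalZmodule.Build (bohr R G)
    bohr_sub_continuous.
End BohrTopology.

Definition bohr_map (R : realType) (G H : zmodType) (f : {additive G -> H}) :
  {additive bohr R G -> bohr R H} := f.

Definition quotient_map (G : zmodType) (H : zmodClosed G) :
  {additive G -> Quotient.quot H} := \pi_(Quotient.quot H).

Definition open_map (X Y : topologicalType) (f : X -> Y) : Prop :=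
  forall U : set X, open U -> open (f @` U).

(* A homeomorphism onto its image, the image carrying the subspace topology. *)
Definition topological_embedding (X Y : topologicalType) (f : X -> Y) : Prop :=
  [/\ continuous f, injective f &
      forall U : set X, open U ->
        exists2 V : set Y, open V & f @` U = V `&` range f].

Definition is_extension (B X A : topologicalZmodType)
    (j : {additive B -> X}) (p : {additive X -> A}) : Prop :=
  [/\ topological_embedding j,
      continuous p, range p = [set: A], open_map p &
      range j = p @^-1` [set 0]].

Definition is_ws_extension (B X A : topologicalZmodType)
    (j : {additive B -> X}) (p : {additive X -> A}) : Prop :=
  is_extension j p /\
  exists s : A -> X, [/\ continuous s, cancel s p & s 0 = 0].

(* Main.v *)
(* Every character f of G has the form f x = g (p x) + t x mod Z with g a
   character of G/Z and t real: take t with f 1 = t mod Z. Hence a map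
   s : (G/Z)^# -> G^# with p s = id is continuous as soon as it is continuous
   into R with its usual topology. Such a map exists although R -> R/Z has no
   continuous section: an additive retraction r : R -> Q (Zorn) splits the
   identity of R/Z as the sum of the discontinuous characters r and id - r,
   each of which misses a point of R/Z and so lifts continuously to R. The
   openness of p follows from s, and j is an embedding because every character
   of Z is n |-> t n mod Z, which extends to G. *)
Require Import Defs.
From HB Require Import structures.
From mathcomp Require Import all_boot all_order all_algebra.
From mathcomp Require Import generic_quotient ring_quotient.
From mathcomp Require Import all_classical all_reals all_analysis.
From mathcomp Require Import ring lra.

Import Order.TTheory GRing.Theory Num.Theory.
Import numFieldNormedType.Exports.
Local Open Scope classical_set_scope.
Local Open Scope ring_scope.
Local Open Scope quotient_scope.

(** * Lifting circle-valued maps that miss a point *)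

Section CircleLift.
Context {R : realType}.
Implicit Types c x : R.

(** The representative of [x] modulo 1 in [[c, c + 1)]. *)
Definition unit_shift c x : R := x - (Num.floor (x - c))%:~R.

Lemma unit_shift_id c x : c <= x < c + 1 -> unit_shift c x = x.
Proof.
move=> /andP[cx xc]; rewrite /unit_shift (@floor_def _ _ 0) ?subr0//.
by rewrite subr_ge0 cx ltrBlDr addrC.
Qed.

Lemma unit_shift_itv c x : c <= unit_shift c x < c + 1.
Proof.
have := floor_itv (x - c); rewrite /unit_shift rmorphD rmorph1 => /andP[].
rewrite lerBrDl ltrBlDr => cx xc.
by rewrite lerBrDr cx/= ltrBlDr addrAC (addrC c) addrAC.
Qed.

Lemma unit_shift_periodic c {x y} :
  circle_pi x = circle_pi y -> unit_shift c x = unit_shift c y.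
Proof.
move=> /circle_pi_eq xy; rewrite /unit_shift -(subrK y x) -(addrA (x - y) y (- c)) floorDzr//.
by rewrite rmorphD/= (floorK xy) opprD addrACA subrr add0r.
Qed.

Lemma circle_pi_unit_shift c x : circle_pi (unit_shift c x) = circle_pi x.
Proof. by apply/circle_pi_eq; rewrite /unit_shift addrAC subrr add0r rpredN intr_int. Qed.

(** [circle_pi] is open and injective on []c, c + 1[], with inverse induced by [unit_shift c], and
    values of [g] avoiding [c] modulo 1 are shifted into that interval. Continuity is asked of [g]
    modulo 1 only, so [g] itself may jump. *)
Lemma unit_shift_continuous {Y : topologicalType} {c} {g : Y -> R} :
  continuous (circle_pi \o g) -> (forall y, circle_pi (g y) <> circle_pi c) ->
  continuous (unit_shift c \o g).
Proof.
move=> cg gc y U /= Uy.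
have Iy : `]c, c + 1[%classic (unit_shift c (g y)).
  rewrite /= in_itv/=; have /andP[cy ->] := unit_shift_itv c (g y).
  rewrite andbT lt_neqAle cy andbT; apply/eqP => cgy.
  by apply: (gc y); rewrite -(circle_pi_unit_shift c (g y)) -cgy.
have nI : nbhs (unit_shift c (g y)) `]c, c + 1[%classic.
  by apply: open_nbhs_nbhs; split => //; exact: interval_open.
have := circle_pi_nbhs (filterI Uy nI).
rewrite circle_pi_unit_shift => /(_ (nbhs_filter _)) /(cg y).
apply: (@filterS _ _ (nbhs_filter y)) => z /= [x [Ux]]; rewrite /= in_itv/= => /andP[cx xc] xz.
by rewrite /= -(unit_shift_periodic c xz) unit_shift_id ?(ltW cx).
Qed.

End CircleLift.

(** * An additive retraction of the reals onto the rationals *)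

Section RationalRetraction.
Variable R : realType.

(** By Zorn, take [V] maximal among the rational subspaces that meet the rationals trivially;
    maximality makes it a complement of them. *)
Lemma rational_complement : exists V : set R,
  [/\ V 0, forall x y, V x -> V y -> V (x - y),
      forall (q : rat) x, V x -> V (ratr q * x),
      forall q : rat, V (ratr q) -> q = 0 &
      forall x, exists q : rat, V (x - ratr q)].
Proof.
pose P (V : set R) := [/\ forall x y, V x -> V y -> V (x - y),
      forall (q : rat) x, V x -> V (ratr q * x) &
      forall q : rat, V (ratr q) -> q = 0].
have [F FP tF|V [[VB VZ VQ] maxV]] := @Zorn_bigcup R P.
  split=> [||].
  - move=> x y [A FA Ax] [B FB By].
    have [AB|BA] := tF _ _ FA FB.
      by exists B => //; have [+ _ _] := FP _ FB; apply => //; exact: AB.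
    by exists A => //; have [+ _ _] := FP _ FA; apply => //; exact: BA.
  - by move=> q x [A FA Ax]; exists A => //; have [_ + _] := FP _ FA; exact.
  - by move=> q [A FA Ax]; have [_ _] := FP _ FA; exact.
(* The alternative [v = 0] covers an empty V, which Zorn's lemma does not exclude. *)
pose W x := [set z | exists v (q : rat), (V v \/ v = 0) /\ z = v + ratr q * x].
(* If [V + Q x] still meets the rationals trivially, it satisfies [P], and maximality forces [x]
   into [V]. *)
have ext x : (forall q : rat, W x (ratr q) -> q = 0) -> V x.
  move=> WQ; suff VW : V `<=` W x.
    have PW : P (W x).
      split=> //.
      - move=> _ _ [v [q [Vv ->]]] [w [r [Vw ->]]]; exists (v - w), (q - r); split.
          case: Vv Vw => [Vv|->] [Vw|->]; rewrite ?subr0 ?sub0r; [|by left| |by right].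
            by left; exact: VB.
          by left; rewrite -mulN1r -(rmorphN1 ratr); exact: VZ.
        by rewrite rmorphB/= mulrBl opprD addrACA.
      - move=> r _ [v [q [Vv ->]]]; exists (ratr r * v), (r * q); split.
          by case: Vv => [Vv|->]; [left; exact: VZ|right; rewrite mulr0].
        by rewrite rmorphM/= mulrDr mulrA.
    apply: contrapT => nVx; apply: (maxV (W x)) => //; split=> // WV; apply: nVx.
    by apply: WV; exists 0, 1; rewrite rmorph1 mul1r add0r; split => //; right.
  by move=> v Vv; exists v, 0; rewrite rmorph0 mul0r addr0; split => //; left.
have V0 : V 0.
  apply: ext => q [v [r [Vv]]]; rewrite mulr0 addr0 => qv.
  case: Vv => [|v0]; first by rewrite -qv; exact: VQ.
  by apply/eqP; rewrite -(fmorph_eq0 (@ratr R)) /= qv v0.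
exists V; split=> // x.
(* A relation [q = v + r x] with [q] nonzero forces [r] nonzero, and then [x - q / r = - v / r] is
   in [V]. Without such a relation, [ext] puts [x] itself in [V]. *)
have [[q [Wq q0]]|/forallNP nq] :=
    pselect (exists q : rat, (exists v (r : rat), V v /\ ratr q = v + ratr r * x) /\ q <> 0).
  move: Wq => [v [r [Vv qvr]]].
  have r0 : r != 0.
    by apply/eqP => r0; apply/q0/VQ; rewrite qvr r0 rmorph0 mul0r addr0.
  exists (q / r); have -> : x - ratr (q / r) = ratr (- r^-1) * v.
    rewrite rmorphM/= qvr rmorphN fmorphV/=.
    have : ratr r != 0 :> R by rewrite fmorph_eq0.
    by move=> r0'; field.
  exact: VZ.
exists 0; rewrite rmorph0 subr0; apply: ext => q [v [r [Vv qvr]]].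
apply: contrapT => q0; apply: (nq q); split=> //; exists v, r; split => //.
by case: Vv => [|->].
Qed.

(** This is the projection along [V]: the rational [q] with [x - q] in [V] is unique, which gives
    additivity. *)
Lemma rational_retraction : exists r : {additive R -> rat}, cancel ratr r.
Proof.
have [V [V0 VB VZ VQ /choice[r Vr]]] := rational_complement.
have uniq x q : V (x - ratr q) -> r x = q.
  move=> Vq; apply/eqP; rewrite -subr_eq0; apply/eqP/VQ.
  by rewrite rmorphB/=; have := VB _ _ Vq (Vr x); congr V; ring.
have rB : zmod_morphism r.
  move=> x y; apply: uniq; rewrite rmorphB/=.
  by have := VB _ _ (Vr x) (Vr y); congr V; ring.
exists (HB.pack_for {additive R -> rat} r (GRing.isZmodMorphism.Build _ _ r rB)).
by move=> q /=; apply: uniq; rewrite subrr.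
Qed.

(** The witness is pi reduced modulo 1. The bounds on [c] place 0 inside []c, c + 1[], so that
    [unit_shift c] fixes 0. *)
Lemma exists_irrational : exists2 c : R, -1 < c < 0 & forall q : rat, ratr q <> c.
Proof.
have cQ (q : rat) : ratr q <> unit_shift (-1) (@pi R).
  move=> qc; apply: (@pi_irrationnal R).
  exists (q + (Num.floor (@pi R - -1))%:~R) => //.
  by rewrite rmorphD/= ratr_int qc subrK.
exists (unit_shift (-1) pi) => //.
have := unit_shift_itv (-1) (@pi R); rewrite addNr le_eqVlt => /andP[].
by move=> /predU1P[c1|-> ->//]; case: (cQ (-1)); rewrite rmorphN1.
Qed.

End RationalRetraction.

Lemma quotient_descent {G M : zmodType} {H : zmodClosed G} (f : {additive G -> M}) :
  {in H, forall x, f x = 0} ->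
  exists g : {additive Quotient.quot H -> M}, forall x, g (quotient_map H x) = f x.
Proof.
move=> fH; pose g0 (y : Quotient.quot H) := f (repr y).
have g0E x : g0 (\pi x) = f x.
  apply/eqP; rewrite -subr_eq0 -raddfB; apply/eqP/fH.
  by rewrite Quotient.idealrBE reprK.
have g0B : zmod_morphism g0.
  by move=> x y; rewrite -[x]reprK -[y]reprK -raddfB !g0E raddfB.
exists (HB.pack_for {additive Quotient.quot H -> M} g0
  (GRing.isZmodMorphism.Build _ _ g0 g0B)) => x.
exact: g0E.
Qed.

Lemma quotient_map_eq {G : zmodType} {H : zmodClosed G} (x y : G) :
  quotient_map H x = quotient_map H y <-> x - y \in H.
Proof. by rewrite Quotient.idealrBE; split=> /(@eqP (Quotient.quot H)). Qed.

(** * Continuity, embeddings and open maps for Bohr topologies *)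

Section BohrContinuity.
Context {R : realType}.

Lemma continuous_to_bohr {X : topologicalType} {G : zmodType} (h : X -> bohr R G) :
  (forall f : {additive G -> circle R}, continuous (fun x => f (h x))) ->
  continuous h.
Proof.
move=> fh x; apply/(@cvg_sup _ _ _ _ (h x : G)) => f; move: x.
exact: (@continuous_comp_initial _ _ _ f h (fh f)).
Qed.

Lemma bohr_map_continuous {G H : zmodType} (f : {additive G -> H}) :
  continuous (bohr_map R f).
Proof.
by apply: continuous_to_bohr => g; exact: (@bohr_hom_continuous R G (g \o f)).
Qed.

(** Since characters of [H] extend along [j], they are all continuous for the topology that [j]
    induces on [H], which is therefore at least as fine as the Bohr topology of [H]. *)
Lemma bohr_embedding {G H : zmodType} (j : {additive H -> G}) :
  injective j ->
  (forall f : {additive H -> circle R},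
    exists g : {additive G -> circle R}, forall x, g (j x) = f x) ->
  topological_embedding (bohr_map R j).
Proof.
move=> jI ext; split=> [|//|U oU]; first exact: bohr_map_continuous.
pose jW : initial_topology (bohr_map R j) -> bohr R G := bohr_map R j.
have cid : continuous (idfun : initial_topology (bohr_map R j) -> bohr R H).
  apply: continuous_to_bohr => f; have [g gj] := ext f.
  rewrite (_ : (fun x => _) = g \o jW); last by apply/funext => x; rewrite -gj.
  move=> x; apply: (@continuous_comp _ _ _ jW g).
    exact: initial_continuous.
  exact: (@bohr_hom_continuous R G g).
have /continuousP/(_ U oU)[V oV VU] := cid.
exists V => //; rewrite -[U]/(idfun @^-1` U) -VU.
apply/seteqP; split=> [_ [x Vx <-]|z [Vz [x _ xz]]]; first by split=> //; exists x.
by exists x => //=; rewrite xz.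
Qed.

Lemma continuous_add {X : topologicalType} {M : topologicalZmodType} {f g : X -> M} :
  continuous f -> continuous g -> continuous (fun x => f x + g x).
Proof.
move=> cf cg x; apply: (@continuous_comp _ _ _ (fun x => (f x, g x))
  (fun z : M * M => z.1 + z.2)); last exact: add_continuous.
by apply: cvg_pair; [exact: cf | exact: cg].
Qed.

(* Around p x, the translate of s by x - s (p x) is a continuous section through x. *)
Lemma open_map_of_section {X A : topologicalZmodType} (p : {additive X -> A}) (s : A -> X) :
  continuous s -> cancel s p -> open_map p.
Proof.
move=> cs sK U oU; rewrite openE => _ [x Ux <-].
pose t y := s y + (x - s (p x)).
have ct : continuous t.
  by apply: continuous_add => // y; exact: cvg_cst.
have tpx : t (p x) = x by rewrite /t addrCA subrr addr0.
have : nbhs (p x) (t @^-1` U) by apply: ct; rewrite tpx; exact: open_nbhs_nbhs.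
apply: (@filterS _ _ (nbhs_filter (p x))) => y /= Uty; exists (t y) => //.
by rewrite /t raddfD raddfB !sK subrr addr0.
Qed.
End BohrContinuity.

(** * Characters of [G] and [G/Z], and the continuous section *)

Section RealSubgroup.
Context {R : realType}.

HB.instance Definition _ :=
  GRing.isZmodMorphism.Build R (circle R) circle_pi (@circle_piB R).

Lemma circle_piK : cancel repr (@circle_pi R).
Proof. by move=> z; exact: (@reprK R (circle R)). Qed.

Lemma circle_pi_eq0 (x : R) : circle_pi x = 0 <-> x \is a Num.int.
Proof. by rewrite -(raddf0 circle_pi) circle_pi_eq subr0. Qed.

Context {G : zmodClosed R} (ZG : {subset integers R <= G}).
Local Notation GZ := (Quotient.quot (relative_subgroup G (integers R))).
Local Notation p := (quotient_map (relative_subgroup G (integers R))).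

Lemma character_on_integers (f : {additive subgroup G -> circle R}) :
  exists t : R, forall x : subgroup G, val x \is a Num.int -> f x = circle_pi (t * val x).
Proof.
have G1 : 1 \in G by apply: ZG; exact: rpred1.
exists (repr (f (Subgroup G1))) => x /intrP[n xn].
have -> : x = Subgroup G1 *~ n by apply: val_inj; rewrite xn raddfMz.
by rewrite !raddfMz/= mulrzr (raddfMz circle_pi)/= circle_piK.
Qed.

Lemma quotient_map_val_eq (x y : subgroup G) :
  p x = p y <-> circle_pi (val x) = circle_pi (val y).
Proof. by rewrite quotient_map_eq circle_pi_eq -raddfB. Qed.

Lemma circle_pi_repr (x : subgroup G) :
  circle_pi (val (repr (p x))) = circle_pi (val x).
Proof. by apply/quotient_map_val_eq; exact: reprK. Qed.

(** Modulo 1, such an [F] descends to a character of [G/Z], continuous by definition of the Bohr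
    topology even if [F] is discontinuous on the line. *)
Lemma quotient_character_continuous (F : {additive R -> R}) :
  (forall x, x \is a Num.int -> F x \is a Num.int) ->
  continuous (fun y : bohr R GZ => circle_pi (F (val (repr (y : GZ))))).
Proof.
move=> FZ; have [x xZ|g gE] := quotient_descent (circle_pi \o F \o val)
  (H := relative_subgroup G (integers R)).
  by apply/circle_pi_eq0; exact: FZ.
rewrite (_ : (fun _ => _) = g); first exact: (@bohr_hom_continuous R GZ g).
by apply/funext => y; rewrite -[in RHS](reprK (y : GZ)) gE.
Qed.

(* r mod Z misses an irrational c, and id - r misses -1/2 since r fixes Q. *)
Lemma bohr_quotient_lift :
  exists S : bohr R GZ -> R, [/\ continuous S, S 0 = 0 &
    forall x, circle_pi (S (p x)) = circle_pi (val x)].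
Proof.
have [r rK] := rational_retraction R.
have [c /andP[c1 c0] cQ] := exists_irrational R.
pose F1 : {additive R -> R} := ratr \o r.
pose F2 : {additive R -> R} := idfun \- F1.
have F1Q q : F1 (ratr q) = ratr q by rewrite /= rK.
have F1Z n : n \is a Num.int -> F1 n = n.
  by move=> /intrP[m ->]; rewrite -(ratr_int R) F1Q.
have F2Z n : n \is a Num.int -> F2 n = 0.
  by move=> nZ; rewrite -[F2 n]/(n - F1 n) F1Z// subrr.
pose v (y : bohr R GZ) : R := val (repr (y : GZ)).
pose S (y : bohr R GZ) : R := unit_shift c (F1 (v y)) + unit_shift (- 2^-1) (F2 (v y)).
exists S; split.
- have c1' : continuous (unit_shift c \o (F1 \o v)).
    apply: unit_shift_continuous.
      by apply: (quotient_character_continuous F1) => x xZ; rewrite F1Z.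
    move=> y /circle_pi_eq /intrP[n] /= e; apply: (cQ (r (v y) - n%:~R)).
    by rewrite rmorphB/= ratr_int -e subKr.
  have c2' : continuous (unit_shift (- 2^-1) \o (F2 \o v)).
    apply: unit_shift_continuous.
      by apply: (quotient_character_continuous F2) => x xZ; rewrite F2Z.
    move=> y /circle_pi_eq /intrP[n] /= e.
    (* If [F2 (v y)] were [n - 1/2], then [v y] would be rational, hence fixed by [F1] and killed by
       [F2], giving [n = 1/2]. *)
    have vQ : v y = ratr (r (v y) + n%:~R - 2^-1).
      by rewrite rmorphB rmorphD/= ratr_int -e fmorphV/= ratr_nat; ring.
    have : v y - F1 (v y) = 0 by rewrite vQ F1Q subrr.
    move=> /= v0; move: e; rewrite v0 sub0r opprK => n2.
    have : 0 < (n%:~R : R) < 1 by rewrite -n2; lra.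
    by rewrite ltr0z ltrz1 gtz0_ge1 leNgt andNb.
  by move=> y; exact: (cvgD (c1' y) (c2' y)).
(* The chosen representative of the zero class is only known to be an integer; periodicity of
   [unit_shift c] replaces it by 0. *)
- have v0 : v 0 \is a Num.int.
    by apply/circle_pi_eq0; rewrite /v -(raddf0 p) circle_pi_repr !raddf0.
  rewrite /S (F2Z _ v0) (F1Z _ v0) (unit_shift_periodic c (y := 0)).
    by rewrite !unit_shift_id ?addr0//; lra.
  by rewrite raddf0; apply/circle_pi_eq0.
- move=> x; rewrite -(circle_pi_repr x) raddfD/= !circle_pi_unit_shift -raddfD/=.
  by rewrite addrC subrK.
Qed.

Lemma bohr_quotient_section : exists s : bohr R GZ -> bohr R (subgroup G),
  [/\ continuous s, cancel s (bohr_map R p) & s 0 = 0].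
Proof.
have [S [cS S0 SE]] := bohr_quotient_lift.
(* [S y] differs from a representative of [y] in [G] by an integer. *)
have SG y : S y \in G.
  rewrite -(subrK (val (repr (y : GZ))) (S y)).
  apply: rpredD; last exact: (valP (repr (y : GZ))).
  by apply/ZG/circle_pi_eq; rewrite -(SE (repr (y : GZ))) [p _]reprK.
pose s (y : bohr R GZ) : bohr R (subgroup G) := Subgroup (SG y).
have sK : cancel s (bohr_map R p).
  move=> y; rewrite -[RHS](reprK (y : GZ)); apply/quotient_map_val_eq.
  by rewrite -(SE (repr (y : GZ))) [p _]reprK.
exists s; split=> //; last by apply: val_inj; exact: S0.
apply: continuous_to_bohr => f.
have [t ft] := character_on_integers f.
pose h : {additive subgroup G -> circle R} :=
  circle_pi \o (t \*o val).
pose fh : {additive subgroup G -> circle R} := f \- h.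
have [x xZ|g gE] := quotient_descent fh
  (H := relative_subgroup G (integers R)).
  by rewrite /= ft// subrr.
(* Evaluating [f = g \o p + h] at [s y] turns [p (s y)] into [y] and leaves [t * S y] modulo 1. *)
rewrite (_ : (fun _ => _) = (fun y : bohr R GZ => g y + circle_pi (t * S y))).
  apply: continuous_add; first exact: (@bohr_hom_continuous R GZ g).
  move=> y; apply: (@continuous_comp _ _ _ (fun y => t * S y) circle_pi).
    exact: (cvgM (cvg_cst _) (cS y)).
  exact: circle_pi_continuous.
by apply/funext => y; rewrite -{2}(sK y) [g _]gE /= subrK.
Qed.

End RealSubgroup.

Theorem proposition5p19 (R : realType) (G : zmodClosed R)
    (ZG : {subset integers R <= G}) :
  is_ws_extension
    (bohr_map R (inclusion ZG))
    (bohr_map R (quotient_map (relative_subgroup G (integers R)))).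
Proof.
have [s [cs sK s0]] := bohr_quotient_section ZG.
split; last by exists s.
split.
- apply: bohr_embedding => [x y [xy]|f]; first exact: val_inj.
  (* Here the subgroup is the integers themselves, so [t] determines all of [f]; multiplication by
     [t] modulo 1 then makes sense on [G]. *)
  have [t ft] := character_on_integers (fun _ => id) f.
  exists (circle_pi \o (t \*o val)) => x; rewrite ft//.
  exact: (valP x).
- exact: bohr_map_continuous.
- by apply/seteqP; split=> // y _; exists (s y).
- exact: (open_map_of_section _ s).
- apply/seteqP; split=> [_ [x _ <-]|x /= px0].
    rewrite /= -[RHS](raddf0 (bohr_map R (quotient_map (relative_subgroup G (integers R))))).
    apply/quotient_map_eq; rewrite subr0; exact: (valP x).
  have xZ : val x \in integers R.
    have := px0.
    rewrite -[RHS](raddf0 (bohr_map R (quotient_map (relative_subgroup G (integers R))))).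
    by move=> /quotient_map_eq; rewrite subr0.
  by exists (Subgroup xZ) => //; apply: val_inj.
Qed.
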